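(* Let $(M_n(x))_{n\ge 0}$ and $(N_n(x))_{n\ge 0}$ be the polynomials determined by $M_0(x)=N_0(x)=1$ and, for $n\ge 1$, $N_n(x)=nxM_{n-1}(x)+nN_{n-1}(x)$ and $M_n(x)=n(x+1)M_{n-1}(x)+nN_{n-1}(x)$. Then for all $n\ge 1$, $$N_n(x)=M_n(x)-nM_{n-1}(x)$$ and $$M_{n+1}(x)=(n+1)(x+2)M_n(x)-n(n+1)M_{n-1}(x).$$ Moreover, for all $n\ge 0$, $$M_n(x)=n!\sum_{k=0}^{n}\binom{n+k+1}{n-k}x^k.$$
   Context: $M_n(x)$ and $N_n(x)$ are polynomials in an indeterminate $x$ with real coefficients, defined by the simultaneous recurrence in the claim. *)

(* Defs.v *)
From HB Require Import structures.
From mathcomp Require Import all_boot all_order all_algebra.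
From mathcomp Require Import reals.

(* Main.v *)
Require Import Defs.
From mathcomp Require Import all_boot all_order all_algebra.
From mathcomp Require Import reals.
From mathcomp Require Import zify ring.
Import GRing.Theory.
Local Open Scope ring_scope.

(** Once the factorials are divided out, the recurrence is that of the two
    families of Morgan-Voyce polynomials

      [B n = \sum_k 'C(n + k + 1, 2k + 1) X^k],
      [b n = \sum_k 'C(n + k, 2k) X^k]:

    Pascal's rule, read on coefficients, says exactly that
    [b n.+1 = X * B n + b n] ([morgan_voyce_bS]) and [B n.+1 = B n + b n.+1]
    ([morgan_voyce_BS]).  Hence [M n = n! B n] and [N n = n! b n] by a
    simultaneous induction, and the symmetry of binomial coefficients turns
    ['C(n + k + 1, 2k + 1)] into ['C(n + k + 1, n - k)].  The other two claims
    hold at the level of the recurrence: subtracting its two equations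
    eliminates [N n.-1] and gives [N n = M n - n M n.-1], and substituting this
    in the equation for [M n.+1] gives the three-term recurrence. *)

(** Writing the lower index as [2k + 1], resp. [2k], instead of [n - k] makes
    the coefficient formula valid for every [k], since the binomial vanishes
    for [k > n], whereas ['C(n + k + 1, n - k)] would be [1] there because the
    subtraction is truncated. *)
Definition morgan_voyce_B (R : nzRingType) (n : nat) : {poly R} :=
  \poly_(k < n.+1) 'C(n + k + 1, k.*2.+1)%:R.

Definition morgan_voyce_b (R : nzRingType) (n : nat) : {poly R} :=
  \poly_(k < n.+1) 'C(n + k, k.*2)%:R.

Lemma coef_morgan_voyce_B (R : nzRingType) (n k : nat) :
  (morgan_voyce_B R n)`_k = 'C(n + k + 1, k.*2.+1)%:R.
Proof.
rewrite coef_poly; case: ltnP => // lt_nk.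
by rewrite bin_small //; lia.
Qed.

Lemma coef_morgan_voyce_b (R : nzRingType) (n k : nat) :
  (morgan_voyce_b R n)`_k = 'C(n + k, k.*2)%:R.
Proof.
rewrite coef_poly; case: ltnP => // lt_nk.
by rewrite bin_small //; lia.
Qed.

Lemma morgan_voyce_B0 (R : nzRingType) : morgan_voyce_B R 0 = 1.
Proof.
apply/polyP=> k; rewrite coef_morgan_voyce_B coef1.
by case: k => [|k] //; rewrite bin_small //; lia.
Qed.

Lemma morgan_voyce_b0 (R : nzRingType) : morgan_voyce_b R 0 = 1.
Proof.
apply/polyP=> k; rewrite coef_morgan_voyce_b coef1.
by case: k => [|k] //; rewrite bin_small //; lia.
Qed.

Lemma morgan_voyce_bS (R : nzRingType) (n : nat) :
  morgan_voyce_b R n.+1 = 'X * morgan_voyce_B R n + morgan_voyce_b R n.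
Proof.
apply/polyP=> -[|k]; rewrite coefD coefXM !coef_morgan_voyce_b /=.
  by rewrite !bin0 add0r.
by rewrite coef_morgan_voyce_B doubleS addSn binS natrD addrC addn1 addnS.
Qed.

Lemma morgan_voyce_BS (R : nzRingType) (n : nat) :
  morgan_voyce_B R n.+1 = morgan_voyce_B R n + morgan_voyce_b R n.+1.
Proof.
apply/polyP=> k; rewrite coefD !coef_morgan_voyce_B coef_morgan_voyce_b.
by rewrite !addn1 binS natrD addSn.
Qed.

Lemma morgan_voyce_B_sum (R : nzRingType) (n : nat) :
  morgan_voyce_B R n =
  \sum_(0 <= k < n.+1) 'C(n + k + 1, n - k)%:R * 'X^k.
Proof.
rewrite /morgan_voyce_B poly_def big_mkord; apply: eq_bigr => k _.
have le_kn : (k <= n)%N by rewrite -ltnS.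
rewrite scaler_nat mulr_natl -bin_sub; last by lia.
by congr (_ *+ 'C(_, _)); lia.
Qed.

Theorem theorem3p1 (R : realType) (M N : nat -> {poly R})
    (M0 : M 0%N = 1) (N0 : N 0%N = 1)
    (NE : forall n : nat, (1 <= n)%N ->
       N n = n%:R * 'X * M (n - 1)%N + n%:R * N (n - 1)%N)
    (ME : forall n : nat, (1 <= n)%N ->
       M n = n%:R * ('X + 1) * M (n - 1)%N + n%:R * N (n - 1)%N) :
  (forall n : nat, (1 <= n)%N ->
     N n = M n - n%:R * M (n - 1)%N /\
     M (n + 1)%N = (n + 1)%:R * ('X + 2%:R) * M n
                   - (n * (n + 1))%:R * M (n - 1)%N) /\
  (forall n : nat,
     M n = (n`!)%:R * \sum_(0 <= k < n.+1) 'C(n + k + 1, n - k)%:R * 'X^k).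
Proof.
have NM n : (1 <= n)%N -> N n = M n - n%:R * M (n - 1)%N.
  by move=> n_gt0; rewrite (NE n) // (ME n) //; ring.
split=> [n n_gt0|n].
  split; first exact: NM.
  rewrite ME ?addn1 // subn1 /= NM // natrM; ring.
rewrite -morgan_voyce_B_sum.
suff [] : M n = (n`!)%:R * morgan_voyce_B R n /\
          N n = (n`!)%:R * morgan_voyce_b R n by [].
elim: n => [|n [IHM IHN]].
  by rewrite M0 N0 morgan_voyce_B0 morgan_voyce_b0 mulr1.
rewrite (NE n.+1) // (ME n.+1) // !subn1 /= IHM IHN morgan_voyce_BS morgan_voyce_bS.
by rewrite factS natrM; split; ring.
Qed.
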